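(* Let $L$ be an $(m\mid n)$-dimensional nilpotent Lie superalgebra over a field of characteristic different from $2$ and $3$, with $m+n\geq 4$, $n\geq 1$ and $\dim L^2=m+n-2$. Put $\gamma(L)=m+2n-2-\dim\mathcal{M}(L)$. If $\gamma(L)=2$, then $L$ is capable.
   Context: A Lie superalgebra $L=L_{\overline 0}\oplus L_{\overline 1}$ has dimension $(m\mid n)$ if $\dim L_{\overline 0}=m$ and $\dim L_{\overline 1}=n$; for a graded space, $\dim$ without further specification is the total dimension. $L^2=[L,L]$ is the derived subsuperalgebra. $L$ is nilpotent if its lower central series $C^0(L)=L$, $C^{i+1}(L)=[L,C^i(L)]$ reaches $0$. If $L\cong F/R$ with $F$ a free Lie superalgebra and $R$ a graded ideal, the Schur multiplier of $L$ is $\mathcal{M}(L)\cong (R\cap F^2)/[R,F]$. A Lie superalgebra $L$ is capable if there exists a Lie superalgebra $M$ such that $L\cong M/Z(M)$, where $Z(M)$ is the center of $M$. *)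

(* Defs.v *)
From HB Require Import structures.
From mathcomp Require Import all_boot all_order all_algebra.
From mathcomp Require Import mathcomp_extra boolp classical_sets.

Set Implicit Arguments.
Unset Strict Implicit.
Unset Printing Implicit Defensive.

Import GRing.Theory.
Local Open Scope classical_set_scope.
Local Open Scope ring_scope.
Local Open Scope quotient_scope.

Section Subspaces.
Variables (K : fieldType) (V : lmodType K).

Definition is_subspace (S : set V) : Prop :=
  S 0 /\ forall (a : K) (x y : V), S x -> S y -> S (a *: x + y).

Record subspace := Subspace {
  subspace_set :> set V;
  subspaceP : is_subspace subspace_set
}.

Definition span (A : set V) : set V := smallest is_subspace A.

Lemma span_is_subspace (A : set V) : is_subspace (span A).
Proof.
split=> [S [[S0 _] _] //|a x y Ax Ay S SA].
by case: (SA) => -[_ SD] _; apply: SD; [apply: Ax|apply: Ay].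
Qed.

Definition span_subspace (A : set V) : subspace :=
  Subspace (span_is_subspace A).

Definition has_dim (S : set V) (d : nat) : Prop :=
  exists e : 'I_d -> V,
    (forall c : 'I_d -> K, \sum_i c i *: e i = 0 -> forall i, c i = 0) /\
    S = [set \sum_i c i *: e i | c in [set: 'I_d -> K]].

End Subspaces.

Section VectorQuotient.
Variables (K : fieldType) (V : lmodType K) (S : subspace V).

Definition subspace_pred : {pred V} := fun x => `[< subspace_set S x >].

Lemma subspace_predP x : reflect (subspace_set S x) (x \in subspace_pred).
Proof. exact: asboolP. Qed.

Lemma subspace_pred_zmod : zmod_closed subspace_pred.
Proof.
have [S0 SD] := subspaceP S.
split=> [|x y /subspace_predP Sx /subspace_predP Sy]; apply/subspace_predP => //.
by rewrite addrC -scaleN1r; apply: SD.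
Qed.

HB.instance Definition _ :=
  GRing.isZmodClosed.Build V subspace_pred subspace_pred_zmod.

Definition vquot : Type := Quotient.quot subspace_pred.
HB.instance Definition _ := GRing.Zmodule.on vquot.

Definition vpi (x : V) : vquot := \pi_(Quotient.quot subspace_pred) x.
Definition vrepr (u : vquot) : V := repr (u : Quotient.quot subspace_pred).

Lemma vreprK u : vpi (vrepr u) = u.
Proof. exact: reprK. Qed.

Lemma vpi_eq x y : vpi x = vpi y <-> subspace_set S (x - y).
Proof.
split=> [/eqP|/subspace_predP]; rewrite /vpi.
  by rewrite -Quotient.idealrBE => /subspace_predP.
by rewrite Quotient.idealrBE => /eqP.
Qed.

Lemma vpiD x y : vpi (x + y) = vpi x + vpi y.
Proof. exact: (@Quotient.pi_add V subspace_pred). Qed.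

Definition vquot_scale (a : K) (u : vquot) : vquot := vpi (a *: vrepr u).

Lemma vpiZ a x : vpi (a *: x) = vquot_scale a (vpi x).
Proof.
apply/vpi_eq; rewrite -scalerBr; have [S0 SD] := subspaceP S.
by rewrite -[_ *: _]addr0; apply: SD => //; apply/vpi_eq; rewrite vreprK.
Qed.

Lemma vquot_scaleA a b u :
  vquot_scale a (vquot_scale b u) = vquot_scale (a * b) u.
Proof. by rewrite -[u]vreprK -!vpiZ scalerA. Qed.

Lemma vquot_scale1 : left_id 1 vquot_scale.
Proof. by move=> u; rewrite -[u]vreprK -!vpiZ scale1r. Qed.

Lemma vquot_scaleDr : right_distributive vquot_scale +%R.
Proof.
by move=> a u v; rewrite -[u]vreprK -[v]vreprK -vpiD -!vpiZ -vpiD scalerDr.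
Qed.

Lemma vquot_scaleDl u : {morph vquot_scale^~ u : a b / a + b}.
Proof. by move=> a b; rewrite -[u]vreprK -!vpiZ -vpiD scalerDl. Qed.

HB.instance Definition _ := GRing.Zmodule_isLmodule.Build K vquot
  vquot_scaleA vquot_scale1 vquot_scaleDr vquot_scaleDl.

Lemma vpi_is_linear : linear vpi.
Proof. by move=> a x y; rewrite vpiD vpiZ. Qed.

HB.instance Definition _ :=
  GRing.isLinear.Build K V vquot *:%R vpi vpi_is_linear.

End VectorQuotient.

(* [lie_part L false] is the even part and [lie_part L true] the odd part, so
   that degrees add up by [addb] and the sign (-1)^(|x||y|) is
   [(-1) ^+ (a && b)].  Pitfall: in characteristic 2 or 3 one would also have
   to impose [x, x] = 0 for x even and [y, [y, y]] = 0 for y odd. *)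
Record lieSuperalgebra (K : fieldType) := LieSuperalgebra {
  lie_sort :> lmodType K;
  lie_part : bool -> set lie_sort;
  lie_br : lie_sort -> lie_sort -> lie_sort;
  lie_part_subspace : forall b, is_subspace (lie_part b);
  lie_part_sum : forall x,
    exists x0 x1, [/\ lie_part false x0, lie_part true x1 & x = x0 + x1];
  lie_part_direct : forall x, lie_part false x -> lie_part true x -> x = 0;
  lie_br_linearl : forall (k : K) x y z,
    lie_br (k *: x + y) z = k *: lie_br x z + lie_br y z;
  lie_br_linearr : forall (k : K) x y z,
    lie_br z (k *: x + y) = k *: lie_br z x + lie_br z y;
  lie_br_part : forall a b x y,
    lie_part a x -> lie_part b y -> lie_part (a (+) b) (lie_br x y);
  lie_br_skew : forall a b x y,
    lie_part a x -> lie_part b y ->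
    lie_br x y = - ((-1) ^+ (a && b) *: lie_br y x);
  lie_br_jacobi : forall a b x y z,
    lie_part a x -> lie_part b y ->
    lie_br x (lie_br y z) =
      lie_br (lie_br x y) z + (-1) ^+ (a && b) *: lie_br y (lie_br x z)
}.

Definition is_lie_hom (K : fieldType) (L M : lieSuperalgebra K)
    (f : {linear L -> M}) : Prop :=
  (forall b x, lie_part b x -> lie_part b (f x)) /\
  (forall x y, f (lie_br x y) = lie_br (f x) (f y)).

Definition lie_iso (K : fieldType) (L M : lieSuperalgebra K) : Prop :=
  exists f : {linear L -> M}, is_lie_hom f /\ bijective f.

Section Structure.
Variables (K : fieldType) (L : lieSuperalgebra K).

Definition br_set (A B : set L) : subspace L :=
  span_subspace [set lie_br x y | x in A & y in B].

Definition derived : subspace L := br_set [set: L] [set: L].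

Fixpoint lower_central (i : nat) : set L :=
  if i is j.+1 then br_set [set: L] (lower_central j) else [set: L].

Definition lie_nilpotent : Prop := exists i, lower_central i = [set 0].

Definition lie_dim (m n : nat) : Prop :=
  has_dim (@lie_part K L false) m /\ has_dim (@lie_part K L true) n.

Definition center : set L := [set x | forall y, lie_br x y = 0].

Definition is_graded_ideal (I : set L) : Prop :=
  [/\ forall x y, I x -> I (lie_br x y),
      forall x y, I x -> I (lie_br y x) &
      forall x, I x -> exists x0 x1,
        [/\ I x0 /\ lie_part false x0, I x1 /\ lie_part true x1 & x = x0 + x1]].

Record gradedIdeal := GradedIdeal {
  ideal_subspace :> subspace L;
  ideal_graded : is_graded_ideal ideal_subspace
}.

Lemma lie_brDl x y z : lie_br (x + y) z = lie_br x z + lie_br y z :> L.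
Proof. by have := lie_br_linearl 1 x y z; rewrite !scale1r. Qed.

Lemma lie_brDr x y z : lie_br z (x + y) = lie_br z x + lie_br z y :> L.
Proof. by have := lie_br_linearr 1 x y z; rewrite !scale1r. Qed.

Lemma lie_br0l z : lie_br 0 z = 0 :> L.
Proof. by apply: (addIr (lie_br 0 z)); rewrite -lie_brDl !add0r. Qed.

Lemma lie_br0r z : lie_br z 0 = 0 :> L.
Proof. by apply: (addIr (lie_br z 0)); rewrite -lie_brDr !add0r. Qed.

Lemma lie_brBl x y z : lie_br (x - y) z = lie_br x z - lie_br y z :> L.
Proof. by have := lie_br_linearl (-1) y x z; rewrite !scaleN1r ![- _ + _]addrC. Qed.

Lemma lie_brBr x y z : lie_br z (x - y) = lie_br z x - lie_br z y :> L.
Proof. by have := lie_br_linearr (-1) y x z; rewrite !scaleN1r ![- _ + _]addrC. Qed.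

Lemma center_is_subspace : is_subspace center.
Proof.
split=> [y|a x y Zx Zy z]; first exact: lie_br0l.
by rewrite lie_br_linearl Zx Zy scaler0 addr0.
Qed.

Lemma center_part x0 x1 : lie_part false x0 -> lie_part true x1 ->
  center (x0 + x1) -> center x0 /\ center x1.
Proof.
move=> x0P x1P Zx.
suff H b y : lie_part b y -> lie_br x0 y = 0 :> L /\ lie_br x1 y = 0 :> L.
  split=> y; have [y0 [y1 [/H[h1 h2] /H[h3 h4] ->]]] := lie_part_sum y;
    by rewrite lie_brDr ?(h1, h2, h3, h4) addr0.
move=> yP; have := Zx y; rewrite lie_brDl => /eqP.
rewrite addr_eq0 => /eqP e.
have P0 := lie_br_part x0P yP; have P1 := lie_br_part x1P yP.
have N c u : lie_part c u -> lie_part c (- u : L).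
  move=> uP; have [Q0 QD] := @lie_part_subspace K L c.
  by rewrite -scaleN1r -[_ *: _]addr0; apply: QD.
have z0 : lie_br x0 y = 0 :> L.
  have P1' := N _ _ P1; rewrite -e in P1'.
  by case: b {yP} P0 P1 P1' => /= *; apply: lie_part_direct.
by split=> //; apply/eqP; rewrite -oppr_eq0 -e z0.
Qed.

Lemma center_graded : is_graded_ideal center.
Proof.
have [Z0 _] := center_is_subspace.
split=> [x y Zx|x y Zx|x]; first by rewrite (Zx y).
  suff -> : lie_br y x = 0 by [].
  have [x0 [x1 [x0P x1P ex]]] := lie_part_sum x; subst x.
  have [Zx0 Zx1] := center_part x0P x1P Zx.
  have [y0 [y1 [y0P y1P ->]]] := lie_part_sum y.
  rewrite lie_brDr !lie_brDl (lie_br_skew y0P x0P) (lie_br_skew y0P x1P).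
  rewrite (lie_br_skew y1P x0P) (lie_br_skew y1P x1P).
  by rewrite !(Zx0 _, Zx1 _) !scaler0 !oppr0 !addr0.
have [x0 [x1 [x0P x1P ->]]] := lie_part_sum x.
by case/(center_part x0P x1P) => *; exists x0, x1.
Qed.

Definition center_ideal : gradedIdeal :=
  @GradedIdeal (Subspace center_is_subspace) center_graded.

End Structure.

Section LieQuotient.
Variables (K : fieldType) (L : lieSuperalgebra K) (I : gradedIdeal L).

Let Q : lmodType K := vquot I.
Let p : L -> Q := @vpi K L I.

Definition lquot_part (b : bool) : set Q := [set p x | x in lie_part b].
Definition lquot_br (u v : Q) : Q := p (lie_br (vrepr u) (vrepr v)).

Lemma lquot_brE x y : lquot_br (p x) (p y) = p (lie_br x y).
Proof.
apply/vpi_eq; have [I0 ID] := subspaceP I.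
set x' := vrepr _; set y' := vrepr _.
have Ix : subspace_set I (x' - x) by apply/vpi_eq; rewrite vreprK.
have Iy : subspace_set I (y' - y) by apply/vpi_eq; rewrite vreprK.
have -> : lie_br x' y' - lie_br x y =
    1 *: lie_br (x' - x) y' + lie_br x (y' - y).
  by rewrite scale1r lie_brBl lie_brBr addrA subrK.
have [Il Ir _] := ideal_graded I.
by apply: ID; [apply: Il|apply: Ir].
Qed.

Lemma lquot_part_subspace b : is_subspace (lquot_part b).
Proof.
have [P0 PD] := @lie_part_subspace K L b.
split; first by exists 0 => //; rewrite /p linear0.
by move=> a _ _ [x Px <-] [y Py <-]; exists (a *: x + y);
  [apply: PD|rewrite /p linearP].
Qed.

Lemma lquot_part_sum u :
  exists x0 x1, [/\ lquot_part false x0, lquot_part true x1 & u = x0 + x1].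
Proof.
have [x0 [x1 [x0P x1P e]]] := lie_part_sum (vrepr u).
exists (p x0), (p x1); split; [by exists x0|by exists x1|].
by rewrite -[LHS]vreprK e /p linearD.
Qed.

Lemma lquot_part_direct u : lquot_part false u -> lquot_part true u -> u = 0.
Proof.
move=> [x Px <-] [y Py /vpi_eq Iyx].
have [_ _ Ig] := ideal_graded I.
have [w0 [w1 [[I0 w0P] [I1 w1P] e]]] := Ig _ Iyx.
suff xw : x = - w0.
  have [I00 ID] := subspaceP I.
  rewrite -[RHS](linear0 (@vpi K L I)); apply/vpi_eq.
  by rewrite subr0 xw -scaleN1r -[_ *: _]addr0; apply: ID.
apply/eqP; rewrite -subr_eq0 opprK; apply/eqP; apply: lie_part_direct.
  have [_ PD] := @lie_part_subspace K L false.
  by rewrite -[x]scale1r; apply: PD.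
have -> : x + w0 = -1 *: w1 + y.
  have -> : y = x + (w0 + w1) by rewrite -e addrC subrK.
  by rewrite scaleN1r [RHS]addrC !addrA addrK.
by have [_ PD] := @lie_part_subspace K L true; apply: PD.
Qed.

Lemma lquot_br_linearl (k : K) x y z :
  lquot_br (k *: x + y) z = k *: lquot_br x z + lquot_br y z.
Proof.
rewrite -[x]vreprK -[y]vreprK -[z]vreprK -linearP !lquot_brE.
by rewrite lie_br_linearl /p linearP.
Qed.

Lemma lquot_br_linearr (k : K) x y z :
  lquot_br z (k *: x + y) = k *: lquot_br z x + lquot_br z y.
Proof.
rewrite -[x]vreprK -[y]vreprK -[z]vreprK -linearP !lquot_brE.
by rewrite lie_br_linearr /p linearP.
Qed.

Lemma lquot_br_part a b x y :
  lquot_part a x -> lquot_part b y -> lquot_part (a (+) b) (lquot_br x y).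
Proof.
move=> [x' Px <-] [y' Py <-]; rewrite lquot_brE.
by exists (lie_br x' y') => //; apply: lie_br_part.
Qed.

Lemma lquot_br_skew a b x y :
  lquot_part a x -> lquot_part b y ->
  lquot_br x y = - ((-1) ^+ (a && b) *: lquot_br y x).
Proof.
move=> [x' Px <-] [y' Py <-]; rewrite !lquot_brE (lie_br_skew Px Py).
by rewrite /p linearN linearZ.
Qed.

Lemma lquot_br_jacobi a b x y z :
  lquot_part a x -> lquot_part b y ->
  lquot_br x (lquot_br y z) =
    lquot_br (lquot_br x y) z + (-1) ^+ (a && b) *: lquot_br y (lquot_br x z).
Proof.
move=> [x' Px <-] [y' Py <-].
rewrite -[z]vreprK -[vpi I (vrepr z)]/(p (vrepr z)) !lquot_brE.
by rewrite (lie_br_jacobi _ Px Py) /p linearD linearZ.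
Qed.

Definition lie_quot : lieSuperalgebra K :=
  LieSuperalgebra lquot_part_subspace lquot_part_sum lquot_part_direct
    lquot_br_linearl lquot_br_linearr lquot_br_part lquot_br_skew
    lquot_br_jacobi.

End LieQuotient.

Definition is_free_on (K : fieldType) (F : lieSuperalgebra K)
    (X : Type) (deg : X -> bool) (i : X -> F) : Prop :=
  (forall x, lie_part (deg x) (i x)) /\
  forall (M : lieSuperalgebra K) (g : X -> M),
    (forall x, lie_part (deg x) (g x)) ->
    exists f : {linear F -> M},
      [/\ is_lie_hom f, (forall x, f (i x) = g x) &
          forall f' : {linear F -> M},
            is_lie_hom f' -> (forall x, f' (i x) = g x) -> f' =1 f].

Definition is_free (K : fieldType) (F : lieSuperalgebra K) : Prop :=
  exists (X : Type) (deg : X -> bool) (i : X -> F), is_free_on deg i.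

(* (R `&` F^2) / [R, F], realized as a subspace of F / [R, F] *)
Definition schur_multiplier (K : fieldType) (F : lieSuperalgebra K)
    (R : gradedIdeal F) : set (vquot (br_set R [set: F])) :=
  [set vpi (br_set R [set: F]) x | x in (R : set F) `&` derived F].

Definition schur_multiplier_dim (K : fieldType) (L : lieSuperalgebra K)
    (d : nat) : Prop :=
  exists (F : lieSuperalgebra K) (R : gradedIdeal F),
    [/\ is_free F, lie_iso L (lie_quot R) & has_dim (@schur_multiplier K F R) d].

Definition capable (K : fieldType) (L : lieSuperalgebra K) : Prop :=
  exists M : lieSuperalgebra K, lie_iso L (lie_quot (center_ideal M)).

(* Main.v *)
(* Write L = F/R.  The algebra M = F/[R,F] is a central extension p : M -> L with
   kernel R/[R,F], so L is capable as soon as Z(M) = ker p; freeness of F plays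
   no role.  Put k = dim L^2 = m + n - 2 and d = dim M(L), so that
   dim M^2 = d + k.  L is generated by two homogeneous elements, not both even;
   let x, y be homogeneous lifts to M.  Then M^2 is spanned by the c brackets
   [x,x], [x,y], [y,y] that do not vanish for parity reasons together with
   [x,b_i] and [y,b_i], where the b_i lift a basis of L^2; hence
   d + k + s <= c + 2k for s independent relations among these c + 2k elements.
   A central z in M with p z <> 0 lies in M^2 up to ker p, and produces enough
   relations to force d < k.  But gamma(L) = 2 says d = k + n - 2, so n = 1, and
   two generators with dim L^2 >= 2 exclude n = 1. *)
Require Import Defs.
From HB Require Import structures.
From mathcomp Require Import all_boot all_order all_algebra.
From mathcomp Require Import boolp classical_sets zify.

Set Implicit Arguments.
Unset Strict Implicit.
Unset Printing Implicit Defensive.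

Import GRing.Theory.
Local Open Scope ring_scope.

(** * Linear algebra: counting independent vectors against relations *)

Section Linear.
Variables (K : fieldType) (V : lmodType K).
Implicit Types (S W : set V) (x y : V).

Lemma subspaceD S x y : is_subspace S -> S x -> S y -> S (x + y).
Proof. by case=> _ SD Sx Sy; rewrite -[x]scale1r; apply: SD. Qed.

Lemma subspaceZ S (a : K) x : is_subspace S -> S x -> S (a *: x).
Proof. by case=> S0 SD Sx; rewrite -[_ *: _]addr0; apply: SD. Qed.

Lemma subspaceN S x : is_subspace S -> S x -> S (- x).
Proof. by rewrite -scaleN1r; apply: subspaceZ. Qed.

Lemma subspaceB S x y : is_subspace S -> S x -> S y -> S (x - y).
Proof. by move=> SS Sx Sy; apply: subspaceD => //; apply: subspaceN. Qed.

Lemma subspace_sum S n (x : 'I_n -> V) :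
  is_subspace S -> (forall i, S (x i)) -> S (\sum_i x i).
Proof.
by move=> SS Sx; elim/big_ind: _ => //; [case: SS|move=> *; apply: subspaceD].
Qed.

Lemma sub_span (A : set V) x : A x -> Defs.span A x.
Proof. by move=> Ax S [_]; apply. Qed.

Lemma span_min (A : set V) S :
  is_subspace S -> (forall x, A x -> S x) -> forall x, Defs.span A x -> S x.
Proof. by move=> SS AS x; apply; split. Qed.

Lemma line_is_subspace (v : V) : is_subspace [set a *: v | a in [set: K]]%classic.
Proof.
split; first by exists 0; rewrite ?scale0r.
by move=> a _ _ [b _ <-] [c _ <-]; exists (a * b + c); rewrite // scalerDl scalerA.
Qed.

Definition comb n (e : 'I_n -> V) x := exists c : 'I_n -> K, x = \sum_i c i *: e i.

Lemma comb_is_subspace n (e : 'I_n -> V) : is_subspace (comb e).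
Proof.
split; first by exists (fun=> 0); rewrite big1 // => i _; rewrite scale0r.
move=> a _ _ [c ->] [c' ->]; exists (fun i => a * c i + c' i).
rewrite scaler_sumr -big_split; apply: eq_bigr => i _.
by rewrite scalerDl scalerA.
Qed.

Definition indep n (e : 'I_n -> V) :=
  forall c : 'I_n -> K, \sum_i c i *: e i = 0 -> forall i, c i = 0.

(** Write f = P h and stack P over Q. A row relation aP + cQ = 0, evaluated on h, gives a = 0 by
    independence of f, then c = 0 by freeness of Q; so the q + s rows are independent. *)
Lemma indep_relations_leq q s N (h : 'I_N -> V) (f : 'I_q -> V)
    (Q : 'M[K]_(s, N)) :
  indep f -> (forall i, comb h (f i)) ->
  row_free Q -> (forall i, \sum_j Q i j *: h j = 0) -> (q + s <= N)%N.
Proof.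
move=> find /choice[P fP] Qfree Qh.
pose A := col_mx (\matrix_(i, j) P i j) Q.
suff /eqP <- : row_free A by apply: rank_leq_col.
apply: inj_row_free => v; rewrite -[v]hsubmxK mul_row_col.
set a := lsubmx v; set c := rsubmx v => e.
have a0 : a = 0.
  apply/rowP => i; rewrite [RHS]mxE; move: i; apply: (find (fun i => a 0 i)).
  under eq_bigr do rewrite fP scaler_sumr.
  rewrite exchange_big /=.
  have cQ : \sum_i c 0 i *: (\sum_j Q i j *: h j) = 0.
    by rewrite big1 // => i _; rewrite Qh scaler0.
  rewrite -[LHS]addr0 -[X in _ + X = _]cQ.
  under [X in _ + X = _]eq_bigr do rewrite scaler_sumr.
  rewrite [X in _ + X = _]exchange_big -big_split /= big1 // => j _.
  move/rowP/(_ j): e; rewrite !mxE => e.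
  rewrite -[RHS](scale0r (h j)) -e scalerDl !scaler_suml.
  by congr (_ + _); apply: eq_bigr => i _; rewrite scalerA ?mxE.
move: e; rewrite a0 mul0mx add0r => /eqP.
by rewrite mulmx_free_eq0 // => /eqP ->; rewrite row_mx0.
Qed.

Lemma indep_leq q N (h : 'I_N -> V) (f : 'I_q -> V) :
  indep f -> (forall i, comb h (f i)) ->
  (q <= N)%N.
Proof.
move=> find fh; rewrite -[q]addn0.
apply: (@indep_relations_leq q 0 N h f 0) => //; last by case.
by apply: inj_row_free => v _; apply/rowP => -[].
Qed.

Definition snoc n (e : 'I_n -> V) x (i : 'I_(n + 1)) : V :=
  match split i with inl j => e j | inr _ => x end.

Lemma comb_snoc n (e : 'I_n -> V) x y :
  comb (snoc e x) y <-> exists a z, comb e z /\ y = z + a *: x.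
Proof.
split=> [[c ->]|[a [_ [[c ->] ->]]]].
  exists (c (rshift n ord0)), (\sum_i c (lshift 1 i) *: e i).
  split; first by exists (fun i => c (lshift 1 i)).
  rewrite big_split_ord big_ord1 /= /snoc; congr (_ + _).
    by apply: eq_bigr => i _; rewrite (unsplitK (inl i)).
  by rewrite (unsplitK (inr ord0)).
exists (fun i => match split i with inl j => c j | inr _ => a end).
rewrite big_split_ord big_ord1 /= /snoc (unsplitK (inr ord0)); congr (_ + _).
by apply: eq_bigr => i _; rewrite (unsplitK (inl i)).
Qed.

Lemma indep_snoc n (e : 'I_n -> V) x :
  indep e -> ~ comb e x -> indep (snoc e x).
Proof.
move=> eind ex c; rewrite big_split_ord big_ord1 /= /snoc (unsplitK (inr ord0)).
under eq_bigr do rewrite (unsplitK (inl _)).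
move=> e0; have c0 : c (rshift n ord0) = 0.
  apply: contrapT => /eqP c0; apply: ex.
  exists (fun i => - (c (rshift n ord0))^-1 * c (lshift 1 i)).
  move/eqP: e0; rewrite addr_eq0 => /eqP e0.
  under eq_bigr do rewrite -scalerA.
  by rewrite -scaler_sumr e0 scaleNr scalerN opprK scalerA mulVf ?scale1r.
move: e0; rewrite c0 scale0r addr0 => e0 i; rewrite -[i]splitK.
case: split => [j|j] /=; first exact: (eind (fun j => c (lshift 1 j)) e0).
by rewrite ord1.
Qed.

(** The generators are picked among the [e i], so that they can inherit homogeneity. If no two
    sufficed, three of them would extend a basis of S to k + 3 independent vectors in the span of N
    <= k + 2. *)
Lemma two_generators k N (e : 'I_N -> V) (S : set V) :
  has_dim S k -> (forall x, comb e x) -> (0 < N <= k.+2)%N ->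
  exists i j, forall x, exists a b s, S s /\ x = a *: e i + b *: e j + s.
Proof.
move=> [f [find ->]] espan /andP[N0 Nk]; apply: contrapT => H.
have big n (g : 'I_n -> V) : (forall i, comb g (e i)) -> forall x, comb g x.
  move=> ge x; have [c ->] := espan x; move/choice: ge => [d /funext de].
  exists (fun j => \sum_i c i * d i j).
  rewrite de; under eq_bigr do rewrite scaler_sumr.
  rewrite exchange_big; apply: eq_bigr => j _; rewrite scaler_suml.
  by apply: eq_bigr => i _; rewrite scalerA.
(* [o] only fills generator slots whose coefficient is 0. *)
pose o := Ordinal N0.
have step n (g : 'I_n -> V) : ~ (forall x, comb g x) -> exists i, ~ comb g (e i).
  by move=> ng; apply/existsNP => /(big n g).
have [i ei] : exists i, ~ comb f (e i).
  apply: step => fspan; apply: H; exists o, o => x; exists 0, 0, x.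
  by rewrite !scale0r !add0r; split=> //; have [c ->] := fspan x; exists c.
have [j ej] : exists j, ~ comb (snoc f (e i)) (e j).
  apply: step => fspan; apply: H; exists i, o => x.
  have [a [z [[c ->] ->]]] := (comb_snoc f (e i) x).1 (fspan x).
  by exists a, 0, (\sum_i c i *: f i); rewrite scale0r addr0 addrC; split=> //; exists c.
have [l el] : exists l, ~ comb (snoc (snoc f (e i)) (e j)) (e l).
  apply: step => fspan; apply: H; exists i, j => x.
  have [b [y [/comb_snoc[a [z [[c ->] ->]]] ->]]] := (comb_snoc _ (e j) x).1 (fspan x).
  exists a, b, (\sum_i c i *: f i); split; first by exists c.
  by rewrite -addrA addrC.
have := indep_leq (indep_snoc (indep_snoc (indep_snoc find ei) ej) el) (fun i => espan _).
by lia.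
Qed.

Lemma has_dim_comb (S : set V) d : has_dim S d ->
  exists e : 'I_d -> V, [/\ indep e, forall i, S (e i) & forall x, S x -> comb e x].
Proof.
move=> [e [eind ->]]; exists e; split=> // [i|x [c _ <-]]; last by exists c.
exists (fun j => (j == i)%:R) => //; rewrite (bigD1 i) //= eqxx scale1r big1 ?addr0 //.
by move=> j /negPf ->; rewrite scale0r.
Qed.

End Linear.

(** * Lower central series and generation of the derived subalgebra *)

Section Algebra.
Variables (K : fieldType) (L : lieSuperalgebra K).
Implicit Types (x y z : L) (S W : set L).

Lemma lie_brZl (a : K) x z : lie_br (a *: x) z = a *: lie_br x z.
Proof. by have := lie_br_linearl a x 0 z; rewrite !addr0 lie_br0l addr0. Qed.

Lemma lie_brZr (a : K) x z : lie_br z (a *: x) = a *: lie_br z x.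
Proof. by have := lie_br_linearr a x 0 z; rewrite !addr0 lie_br0r addr0. Qed.

Lemma lie_part_hom_sum x : exists x_ : bool -> L,
  (forall b, lie_part b (x_ b)) /\ x = x_ false + x_ true.
Proof.
have [x0 [x1 [h0 h1 ->]]] := lie_part_sum x.
by exists (fun b => if b then x1 else x0); split=> // -[].
Qed.

Lemma homogeneous_ind (P : L -> Prop) :
  (forall x y, P x -> P y -> P (x + y)) -> (forall b x, lie_part b x -> P x) ->
  forall x, P x.
Proof.
move=> PD Phom x; have [x0 [x1 [h0 h1 ->]]] := lie_part_sum x.
by apply: PD; [apply: Phom h0|apply: Phom h1].
Qed.

(** [center] is defined by brackets on one side; the homogeneous components are central too, and
    skew-symmetry applies to them. *)
Lemma center_brr c x : center c -> lie_br x c = 0.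
Proof.
move=> Zc; have [x0 [x1 [h0 h1 ->]]] := lie_part_sum x.
have [c0 [c1 [k0 k1 e]]] := lie_part_sum c.
move: Zc; rewrite e => /(center_part k0 k1)[Z0 Z1].
rewrite lie_brDl !lie_brDr (lie_br_skew h0 k0) (lie_br_skew h1 k0).
by rewrite (lie_br_skew h0 k1) (lie_br_skew h1 k1) !Z0 !Z1 !scaler0 !oppr0 !addr0.
Qed.

Lemma lower_central_subspace i : is_subspace (@lower_central K L i).
Proof. by case: i => [|i] //=; apply: span_is_subspace. Qed.

Lemma lower_central_br i x y : lower_central i y -> lower_central i.+1 (lie_br x y).
Proof. by move=> yi; apply: sub_span; exists x => //; exists y. Qed.

Lemma lower_central_min i S : is_subspace S ->
  (forall x y, lower_central i y -> S (lie_br x y)) ->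
  forall x, lower_central i.+1 x -> S x.
Proof. by move=> SS H; apply: span_min => // _ [x _ [y yi <-]]; apply: H. Qed.

Lemma lower_central_sub i x : lower_central i.+1 x -> lower_central i x.
Proof.
elim: i x => [|i IH] //; apply: lower_central_min => [|x y /IH].
  exact: lower_central_subspace.
exact: lower_central_br.
Qed.

Lemma derived_br x y : subspace_set (derived L) (lie_br x y).
Proof. exact: (@lower_central_br 0). Qed.

(** By Jacobi, [[x, z], y] is a combination of [x, [z, y]] and [z, [x, y]], both two steps further
    down the series. *)
Lemma derived_lower_central i x y :
  subspace_set (derived L) x -> lower_central i y -> lower_central i.+2 (lie_br x y).
Proof.
have D := lower_central_subspace i.+2 => xD yi; move: x xD.
apply: (@lower_central_min 0 [set x | lower_central i.+2 (lie_br x y)]).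
  split; first by rewrite /= lie_br0l; case: D.
  by move=> a u v; rewrite /= lie_br_linearl; apply: D.2.
move=> x z _ /=.
elim/homogeneous_ind: x => [x x' Dx Dx'|a x ax]; first by rewrite !lie_brDl; exact: (subspaceD D).
elim/homogeneous_ind: z => [z z' Dz Dz'|b z bz].
  by rewrite lie_brDr lie_brDl; exact: (subspaceD D).
have /eqP := lie_br_jacobi y ax bz; rewrite -subr_eq => /eqP <-.
by apply: (subspaceB D); [|apply: (subspaceZ _ D)]; do 2! apply: lower_central_br.
Qed.

(* Modulo C^(i+2), C^(i+1) is spanned by iterated brackets of x and y. *)
Lemma derived_sub_stable a b x y W :
  lie_part a x -> lie_part b y ->
  (forall e, exists k l u c, [/\ subspace_set (derived L) u, center c & e = k *: x + l *: y + u + c]) ->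
  lie_nilpotent L -> is_subspace W ->
  W (lie_br x x) -> W (lie_br x y) -> W (lie_br y y) ->
  (forall w, W w -> W (lie_br x w)) -> (forall w, W w -> W (lie_br y w)) ->
  forall u, subspace_set (derived L) u -> W u.
Proof.
move=> ax by_ gen [N nilN] WW Wxx Wxy Wyy Wx Wy.
(* [P i] is W + C^(i+2); induction on i shows that it contains C^(i+1). *)
pose P i v := exists2 w, W w & lower_central i.+2 (v - w).
have Padd i w v : W w -> lower_central i.+2 v -> P i (w + v).
  by move=> Ww Dv; exists w; rewrite // addrC addKr.
have PS i : is_subspace (P i).
  have [W0 WD] := WW; have [D0 DD] := lower_central_subspace i.+2.
  split; first by exists 0; rewrite ?subr0.
  move=> k u v [w Ww Du] [w' Ww' Dv]; exists (k *: w + w'); first exact: WD.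
  by rewrite opprD addrACA -scalerBr; apply: DD.
have main i u : lower_central i.+1 u -> P i u.
  elim: i u => [|i IH]; apply: lower_central_min => // e f.
    (* For i = 0, every term with a factor in L^2 falls into C^2, and only brackets of x and y
       remain. *)
    move=> _; have [k [l [u [c [Du Zc ->]]]]] := gen e.
    have [k' [l' [u' [c' [Du' Zc' ef]]]]] := gen f.
    have -> : lie_br (k *: x + l *: y + u + c) f =
      (k * k') *: lie_br x x + (k * l') *: lie_br x y
      + (l * k') *: lie_br y x + (l * l') *: lie_br y y
      + (lie_br (k *: x + l *: y) u' + lie_br u f).
      rewrite 2![lie_br (_ + _) f]lie_brDl Zc addr0 addrA; congr (_ + _).
      rewrite ef 2!lie_brDr (center_brr _ Zc') addr0; congr (_ + _).
      rewrite lie_brDr !lie_brDl !lie_brZl !lie_brZr !scalerA.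
      by rewrite addrACA !addrA.
    apply: Padd; last first.
      apply: (subspaceD (lower_central_subspace 2)).
        exact: lower_central_br.
      exact: (@derived_lower_central 0).
    rewrite (lie_br_skew by_ ax).
    do !apply: subspaceD => //; do ?[apply: subspaceZ => //].
    by apply: subspaceN => //; apply: subspaceZ.
  move=> /[dup] Df /IH[w Ww Dfw].
  have [k [l [u [c [Du Zc ->]]]]] := gen e.
  (* That w itself lies in C^(i+1) sends [u, w] into C^(i+3). *)
  have Dw : lower_central i.+1 w.
    rewrite -[w](subKr f); apply: (subspaceB (lower_central_subspace _)) => //.
    exact: lower_central_sub.
  set e' := _ + c.
  have -> : lie_br e' f = (k *: lie_br x w + l *: lie_br y w) + (lie_br u w + lie_br e' (f - w)).
    have e'w : lie_br e' w = k *: lie_br x w + l *: lie_br y w + lie_br u w.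
      by rewrite /e' 3!lie_brDl Zc addr0 !lie_brZl.
    by rewrite addrA -e'w lie_brBr addrC subrK.
  apply: Padd; last first.
    apply: (subspaceD (lower_central_subspace _)).
      exact: derived_lower_central.
    exact: lower_central_br.
  by apply: subspaceD => //; apply: subspaceZ => //; [apply: Wx|apply: Wy].
(* Iteration pushes the error term arbitrarily far down the series, where nilpotency kills it. *)
have {}main i u : subspace_set (derived L) u -> exists2 w, W w & lower_central i.+1 (u - w).
  elim: i u => [|i IH] u Du; first by exists 0; rewrite ?subr0 //; case: WW.
  have [w Ww /main[w' Ww' D]] := IH u Du.
  by exists (w + w'); [apply: subspaceD|rewrite opprD addrA].
move=> u /(main N)[w Ww /lower_central_sub]; rewrite nilN => /eqP.
by rewrite subr_eq0 => /eqP ->.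
Qed.

End Algebra.

(** * Bracket identities where 2 and 3 are invertible *)

Section SmallBrackets.
Variables (K : fieldType) (L : lieSuperalgebra K).
Hypotheses (two0 : 2%:R != 0 :> K) (three0 : 3%:R != 0 :> K).
Implicit Types x y t : L.

Lemma even_br_self x : lie_part false x -> lie_br x x = 0.
Proof.
move=> hx; have := lie_br_skew hx hx; rewrite expr0 scale1r => /eqP.
rewrite -addr_eq0 -mulr2n -scaler_nat scaler_eq0 (negPf two0) /=.
by move/eqP.
Qed.

Lemma odd_br_comm x y : lie_part true x -> lie_part true y ->
  lie_br x y = lie_br y x.
Proof.
by move=> hx hy; rewrite (lie_br_skew hx hy) expr1 scaleN1r opprK.
Qed.

(** Jacobi and skew-symmetry give 3 [x, [x, x]] = 0. *)
Lemma odd_br_cube x : lie_part true x -> lie_br x (lie_br x x) = 0.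
Proof.
move=> hx; have := lie_br_jacobi x hx hx.
rewrite (lie_br_skew (lie_br_part hx hx) hx) expr0 expr1 scale1r scaleN1r.
move/eqP; rewrite -subr_eq0 !opprD !opprK.
set u := lie_br _ _; rewrite -mulr2n -mulrS -scaler_nat scaler_eq0 (negPf three0) /=.
by move/eqP.
Qed.

(** Both Jacobi terms equal (-1)^a [y, [x, y]]. *)
Lemma br_odd_square a x y : lie_part a x -> lie_part true y ->
  lie_br x (lie_br y y) =
    (if a then - (2%:R *: lie_br y (lie_br x y)) else 2%:R *: lie_br y (lie_br x y)).
Proof.
move=> hx hy; rewrite (lie_br_jacobi y hx hy).
rewrite (lie_br_skew (lie_br_part hx hy) hy) scaler_nat mulr2n.
case: a hx => hx /=; first by rewrite expr0 expr1 scale1r scaleN1r opprD.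
by rewrite expr0 expr1 scaleN1r opprK scale1r.
Qed.

(** The line of [t, t] is stable under t, since [t, [t, t]] = 0 in either parity; 0 serves as second
    generator in [derived_sub_stable]. *)
Lemma derived_one_generator b t : lie_part b t ->
  (forall e, exists k u c, [/\ subspace_set (derived L) u, center c & e = k *: t + u + c]) ->
  lie_nilpotent L -> forall u, subspace_set (derived L) u ->
  exists a, u = a *: lie_br t t.
Proof.
move=> ht gen nilL u Du; pose W := [set a *: lie_br t t | a in [set: K]]%classic.
suff [a _ <-] : W u by exists a.
have WW : is_subspace W by apply: line_is_subspace.
have h0 : lie_part false (0 : L) by have [] := @lie_part_subspace K L false.
apply: (derived_sub_stable ht h0 _ nilL WW _ _ _ _ _ Du).
- move=> e; have [k [v [c [Dv Zc ->]]]] := gen e.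
  by exists k, 0, v, c; rewrite scale0r addr0.
- by exists 1; rewrite ?scale1r.
- by rewrite lie_br0r; case: WW.
- by rewrite lie_br0r; case: WW.
- move=> _ [a _ <-]; rewrite lie_brZr; case: b ht => ht.
    by rewrite odd_br_cube // scaler0; case: WW.
  by rewrite even_br_self // lie_br0r scaler0; case: WW.
- by move=> w _; rewrite lie_br0l; case: WW.
Qed.

End SmallBrackets.

(** * Central extensions: lifting from L to M, and the size of M^2 *)

Section CentralExtension.
Variables (K : fieldType) (L M : lieSuperalgebra K) (p : {linear M -> L}).
Hypotheses (p_hom : is_lie_hom p) (p_surj : forall y, exists x, p x = y)
  (kerZ : forall x, p x = 0 -> center x).
Implicit Types x y z e u : M.

Let p_br x y : p (lie_br x y) = lie_br (p x) (p y).
Proof. by case: p_hom. Qed.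

Lemma hom_derived u : subspace_set (derived M) u -> subspace_set (derived L) (p u).
Proof.
apply: (@lower_central_min _ _ 0 [set u | subspace_set (derived L) (p u)]%classic).
  have [D0 DD] := lower_central_subspace L 1.
  by split=> [|a v w]; rewrite /= ?linear0 // linearP; apply: DD.
by move=> x y _ /=; rewrite p_br; apply: derived_br.
Qed.

Lemma derived_lift v : subspace_set (derived L) v ->
  exists2 u, subspace_set (derived M) u & p u = v.
Proof.
apply: (@lower_central_min _ _ 0
  [set v | exists2 u, subspace_set (derived M) u & p u = v]%classic).
  have [D0 DD] := lower_central_subspace M 1.
  split=> [|a _ _ [u Du <-] [w Dw <-]]; first by exists 0; rewrite ?linear0.
  by exists (a *: u + w); [apply: DD|rewrite linearP].
move=> x1 y1 _ /=; have [[x <-] [y <-]] := (p_surj x1, p_surj y1).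
by exists (lie_br x y); [apply: derived_br|rewrite p_br].
Qed.

(** The component of parity b of any lift works: the other component maps into both parts of L,
    hence to 0. *)
Lemma part_lift b v : lie_part b v -> exists2 x, lie_part b x & p x = v.
Proof.
have [x <-] := p_surj v; have [x_ [hx ->]] := lie_part_hom_sum x => hv.
exists (x_ b) => //; rewrite linearD.
have pc c : lie_part c (p (x_ c)) by apply: p_hom.1.
have SP c := @lie_part_subspace K L c.
case: b hv => hv.
  suff -> : p (x_ false) = 0 by rewrite add0r.
  apply: lie_part_direct => //.
  by rewrite -[p (x_ false)](addrK (p (x_ true))) -linearD; apply: subspaceB.
suff -> : p (x_ true) = 0 by rewrite addr0.
apply: lie_part_direct => //.
rewrite -[p (x_ true)](addrK (p (x_ false))) [p (x_ true) + _]addrC -linearD.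
exact: subspaceB.
Qed.

(** C^N(M) maps into C^N(L) = 0, so it is central and C^(N+1)(M) = 0. *)
Lemma central_extension_nilpotent : lie_nilpotent L -> lie_nilpotent M.
Proof.
move=> [N nilN]; have low i x : lower_central i x -> lower_central i (p x).
  elim: i x => [|i IH] // x.
  apply: (@lower_central_min _ _ i [set x | lower_central i.+1 (p x)]%classic).
    have [D0 DD] := lower_central_subspace L i.+1.
    by split=> [|a v w]; rewrite /= ?linear0 // linearP; apply: DD.
  by move=> y z /IH zi /=; rewrite p_br; apply: lower_central_br.
exists N.+1; rewrite predeqE => x; split=> [|-> ]; last first.
  by case: (lower_central_subspace M N.+1).
apply: lower_central_min => [|y z /low].
  by split=> [//|a u v -> ->]; rewrite /= scaler0 addr0.
by rewrite nilN => /kerZ Zz; rewrite /= center_brr.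
Qed.

(** Comparing images under [p] means generation modulo M^2 and the kernel of [p]. *)
Definition generate_mod_derived x y := forall e, exists k l u,
  subspace_set (derived M) u /\ p e = k *: p x + l *: p y + p u.

Lemma generate_mod_derivedC x y :
  generate_mod_derived x y -> generate_mod_derived y x.
Proof.
move=> gen e; have [k [l [u [Du ->]]]] := gen e.
by exists l, k, u; split=> //; rewrite [k *: _ + _]addrC.
Qed.

Lemma generate_mod_center x y : generate_mod_derived x y -> forall e,
  exists k l u c, [/\ subspace_set (derived M) u, center c & e = k *: x + l *: y + u + c].
Proof.
move=> gen e; have [k [l [u [Du pe]]]] := gen e.
exists k, l, u, (e - (k *: x + l *: y + u)); split=> //; last by rewrite addrC subrK.
by apply: kerZ; rewrite linearB pe linearD linearP linearZ subrr.
Qed.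

Lemma br_lift_eq x e e' : p e = p e' -> lie_br x e = lie_br x e'.
Proof.
move=> pe; apply/eqP; rewrite -subr_eq0 -lie_brBr center_brr //.
by apply: kerZ; rewrite linearB pe subrr.
Qed.

(* M^2 is spanned by the brackets of the generators and by [x, M^2], [y, M^2];
   as the kernel of p is central, the latter depend only on L^2.  Hence M^2 has
   c + 2k generators, subject to s relations, while dim M^2 = d + k. *)
Lemma derived_relations_leq a b x y c (g : 'I_c -> M) d k s (al de : 'I_s -> M) :
  lie_part a x -> lie_part b y -> generate_mod_derived x y -> lie_nilpotent M ->
  (forall i, subspace_set (derived M) (g i)) ->
  comb g (lie_br x x) -> comb g (lie_br x y) -> comb g (lie_br y y) ->
  has_dim ([set u | p u = 0] `&` derived M)%classic d -> has_dim (derived L) k ->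
  (forall i, subspace_set (derived M) (al i)) ->
  (forall i, subspace_set (derived M) (de i)) ->
  (forall i, lie_br x (al i) + lie_br y (de i) = 0) ->
  indep (fun i => (p (al i), p (de i))) ->
  (d + k + s <= c + (k + k))%N.
Proof.
move=> hx hy gen nilM Dg gxx gxy gyy /has_dim_comb[f [find fker _]].
move=> /has_dim_comb[v [vind Dv vspan]] Dal Dde rel relind.
have /choice[bl blP] i : exists u, subspace_set (derived M) u /\ p u = v i.
  by have [u] := derived_lift (Dv i); exists u.
have DS := lower_central_subspace M 1.
pose be (r : 'rV[K]_k) := \sum_i r 0 i *: bl i.
have be0 : be 0 = 0 by rewrite /be big1 // => i _; rewrite mxE scale0r.
have pbe r : p (be r) = \sum_i r 0 i *: v i.
  by rewrite linear_sum; apply: eq_bigr => i _; rewrite linearZ (blP i).2.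
(* Each u in M^2 has the same image as some [be r], hence the same brackets. *)
have coord u : subspace_set (derived M) u -> exists r, p u = p (be r).
  move=> /hom_derived /vspan[r ->]; exists (\row_i r i).
  by rewrite pbe; apply: eq_bigr => i _; rewrite mxE.
pose h j := match split j with
  | inl i => g i
  | inr j' => match split j' with
    | inl i => lie_br x (bl i) | inr i => lie_br y (bl i) end end.
have brbe t r : lie_br t (be r) = \sum_i r 0 i *: lie_br t (bl i).
  rewrite /be; elim/big_rec2: _ => [|i u w _ <-]; first exact: lie_br0r.
  by rewrite lie_brDr lie_brZr.
have hE (r : 'rV_c) (r1 r2 : 'rV_k) :
    \sum_j row_mx r (row_mx r1 r2) 0 j *: h j =
    \sum_i r 0 i *: g i + (lie_br x (be r1) + lie_br y (be r2)).
  rewrite !big_split_ord !brbe /=; congr (_ + (_ + _)); apply: eq_bigr => i _;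
    by rewrite ?row_mxEr ?row_mxEl /h ?(unsplitK (inl _), unsplitK (inr _)).
have Wg u : comb g u -> comb h u.
  move=> [r ->]; exists (row_mx (\row_i r i) (row_mx 0 0) 0).
  rewrite hE be0 !lie_br0r !addr0.
  by apply: eq_bigr => i _; rewrite mxE.
have Wx u : subspace_set (derived M) u -> comb h (lie_br x u).
  move=> /coord[r /br_lift_eq ->]; exists (row_mx 0 (row_mx r 0) 0).
  by rewrite hE be0 lie_br0r addr0 big1 ?add0r // => i _; rewrite mxE scale0r.
have Wy u : subspace_set (derived M) u -> comb h (lie_br y u).
  move=> /coord[r /br_lift_eq ->]; exists (row_mx 0 (row_mx 0 r) 0).
  by rewrite hE be0 lie_br0r add0r big1 ?add0r // => i _; rewrite mxE scale0r.
have hD j : subspace_set (derived M) (h j).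
  by rewrite /h; case: split => [//|j']; case: split => i; apply: derived_br.
have DW u : comb h u -> subspace_set (derived M) u.
  move=> [r ->]; apply: (subspace_sum DS) => i.
  by apply: (subspaceZ _ DS); apply: hD.
(* The span of [h] is stable: it lies in M^2 and contains [x, M^2] and [y, M^2]. *)
have derW : forall u, subspace_set (derived M) u -> comb h u.
  apply: (derived_sub_stable hx hy (generate_mod_center gen) nilM);
    do ?[exact: comb_is_subspace | exact: Wg].
  - by move=> w /DW; apply: Wx.
  - by move=> w /DW; apply: Wy.
have /choice[ra raP] i := coord _ (Dal i).
have /choice[rd rdP] i := coord _ (Dde i).
(* A basis of the kernel part of M^2 followed by lifts of a basis of L^2; applying [p] first shows
   independence. *)
pose F (i : 'I_(d + k)) := match split i with inl j => f j | inr j => bl j end.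
(* Row i holds the coordinates of [p (al i)] and [p (de i)]: it is the i-th relation written in
   terms of [h]. *)
pose Q := \matrix_(i < s) row_mx (0 : 'rV_c) (row_mx (ra i) (rd i)).
apply: (@indep_relations_leq _ _ _ _ _ h F Q).
- move=> r; rewrite big_split_ord /= /F.
  under eq_bigr do rewrite (unsplitK (inl _)).
  under [X in _ + X]eq_bigr do rewrite (unsplitK (inr _)).
  move=> e0; have r0 : forall i, r (rshift d i) = 0.
    apply: (vind (fun i => r (rshift d i))); have /(congr1 p) := e0.
    rewrite linear0 linearD !linear_sum big1 ?add0r.
      by move=> {2}<-; apply: eq_bigr => i _; rewrite linearZ (blP i).2.
    by move=> i _; have [/= pf _] := fker i; rewrite linearZ /= pf scaler0.
  move: e0; rewrite [X in _ + X]big1 ?addr0; last by move=> i _; rewrite r0 scale0r.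
  move/(find (fun i => r (lshift k i))) => r1 i.
  by rewrite -[i]splitK; case: split => j /=; rewrite ?r0 ?r1.
- move=> i; apply: derW; rewrite /F; case: split => j; first by case: (fker j).
  by case: (blP j).
- apply: inj_row_free => w wQ; apply/rowP => i; rewrite [RHS]mxE.
  apply: (relind (fun i => w 0 i)).
  have wQ0 (t : 'I_s -> 'rV[K]_k) : \sum_i w 0 i *: t i = 0 ->
      \sum_i w 0 i *: p (be (t i)) = 0.
    move=> wt; under eq_bigr do rewrite pbe scaler_sumr.
    rewrite exchange_big big1 //= => j _.
    move/rowP/(_ j): wt; rewrite summxE mxE => wt.
    rewrite -[RHS](scale0r (v j)) -wt scaler_suml.
    by apply: eq_bigr => l _; rewrite scalerA !mxE.
  have : \sum_i w 0 i *: row_mx (0 : 'rV_c) (row_mx (ra i) (rd i)) = 0.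
    rewrite -[RHS]wQ mulmx_sum_row; apply: eq_bigr => l _.
    by rewrite rowK.
  move=> /(congr1 rsubmx); rewrite !linear_sum !linear0.
  under eq_bigr do rewrite linearZ /= row_mxKr.
  move=> e0.
  have ea : \sum_i w 0 i *: ra i = 0.
    move/(congr1 lsubmx): e0; rewrite linear_sum linear0.
    by under eq_bigr do rewrite linearZ /= row_mxKl.
  have ed : \sum_i w 0 i *: rd i = 0.
    move/(congr1 rsubmx): e0; rewrite linear_sum linear0.
    by under eq_bigr do rewrite linearZ /= row_mxKr.
  have := wQ0 _ ea; have := wQ0 _ ed.
  under eq_bigr do rewrite -rdP; move=> e2.
  under eq_bigr do rewrite -raP; move=> e1.
  apply/eqP; rewrite -[_ == _]/(_ && _); apply/andP; split; apply/eqP.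
    by rewrite -[RHS]e1 (raddf_sum fst).
  by rewrite -[RHS]e2 (raddf_sum snd).
- move=> i; under eq_bigr do rewrite mxE; rewrite hE big1 ?add0r.
    by rewrite -(br_lift_eq x (raP i)) -(br_lift_eq y (rdP i)).
  by move=> j _; rewrite mxE scale0r.
Qed.

Lemma line_indep2 (v w : L) (a b : K) : v <> 0 -> (forall c, w <> c *: v) ->
  a *: v + b *: w = 0 -> a = 0 /\ b = 0.
Proof.
move=> v0 wv e; have b0 : b = 0.
  apply: contrapT => /eqP b0; apply: (wv (- (b^-1 * a))); rewrite scaleNr -scalerA.
  by move/eqP: e; rewrite addr_eq0 => /eqP ->; rewrite scalerN opprK scalerA mulVf ?scale1r.
split=> //; move/eqP: e; rewrite b0 scale0r addr0 scaler_eq0 => /orP[/eqP //|/eqP].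
by move/v0.
Qed.

(** The pairs (z, 0), (0, z), (e, 0) encode the relations [x, z] = 0, [y, z] = 0 and [x, e] = 0. *)
Lemma indep_pairs3 z e : p z <> 0 -> (forall a, p e <> a *: p z) ->
  indep (fun i : 'I_3 => (p [:: z; 0; e]`_i, p [:: 0; z; 0]`_i)).
Proof.
move=> z0 ez c; rewrite !big_ord_recl big_ord0 /= !linear0 => cE.
have := congr1 fst cE; have := congr1 snd cE; rewrite /= !scaler0 !addr0 !add0r.
move=> /eqP; rewrite scaler_eq0 => /orP[/eqP c1|/eqP /z0 //] /(line_indep2 z0 ez)[c0 c2].
by case=> [[|[|[|//]]] i]; [rewrite -c0|rewrite -c1|rewrite -c2]; congr c; apply: val_inj.
Qed.

(** The extra pair (q, e) encodes [x, q] + [y, e] = 0. Second components already settle the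
    coefficients of (0, z) and (q, e), so q is arbitrary. *)
Lemma indep_pairs4 z e q : p z <> 0 -> (forall a, p e <> a *: p z) ->
  indep (fun i : 'I_4 => (p [:: z; 0; e; q]`_i, p [:: 0; z; 0; e]`_i)).
Proof.
move=> z0 ez c; rewrite !big_ord_recl big_ord0 /= !linear0 => cE.
have := congr1 fst cE; have := congr1 snd cE; rewrite /= !scaler0 !addr0 !add0r.
move=> /(line_indep2 z0 ez)[c1 c3]; rewrite c3 scale0r addr0.
move=> /(line_indep2 z0 ez)[c0 c2].
by case=> [[|[|[|[|//]]]] i]; [rewrite -c0|rewrite -c1|rewrite -c2|rewrite -c3];
  congr c; apply: val_inj.
Qed.

(** * Degenerate generators excluded by dim L^2 > 1 *)

Hypotheses (two0 : 2%:R != 0 :> K) (three0 : 3%:R != 0 :> K).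
Variables (k d n : nat).
Hypotheses (nilM : lie_nilpotent M) (dimL2 : has_dim (derived L) k) (k_gt1 : (1 < k)%N).

Lemma derived_not_line (v : L) :
  (forall u, subspace_set (derived M) u -> exists a, p u = a *: v) -> False.
Proof.
move=> H; have [f [find Df _]] := has_dim_comb dimL2.
suff : (k <= 1)%N by rewrite leqNgt k_gt1.
apply: (indep_leq (h := fun=> v) find) => i.
have [u /H[a ->] <-] := derived_lift (Df i).
by exists (fun=> a); rewrite big_ord1.
Qed.

(** Otherwise M^2 would be the line of [t, t]. The term [p c] admits central elements outside the
    kernel, as [center_in_derived] requires. *)
Lemma not_one_generator b t : lie_part b t ->
  (forall e, exists l u c,
     [/\ subspace_set (derived M) u, center c & p e = l *: p t + p u + p c]) ->
  False.
Proof.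
move=> ht gen; apply: (@derived_not_line (p (lie_br t t))) => u Du.
have [|a ->] := derived_one_generator two0 three0 ht _ nilM Du; last by exists a; rewrite linearZ.
move=> e; have [l [v [c [Dv Zc pe]]]] := gen e.
exists l, v, (e - (l *: t + v + c) + c); split=> //; last first.
  by rewrite opprD [e + (_ - c)]addrA -[_ - c + c]addrA addNr addr0 [RHS]addrC subrK.
apply: (subspaceD (center_is_subspace M)) => //.
by apply: kerZ; rewrite linearB linearD linearP pe subrr.
Qed.

(** The elements that [p] sends into the line of [p w] form a subspace stable under x and y, because
    brackets depend only on images; it would contain M^2, making L^2 at most a line. *)
Lemma not_line_subalgebra a b x y w :
  lie_part a x -> lie_part b y -> generate_mod_derived x y ->
  lie_br x w = 0 -> lie_br y w = 0 ->
  (exists c, p (lie_br x x) = c *: p w) -> (exists c, p (lie_br x y) = c *: p w) ->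
  (exists c, p (lie_br y y) = c *: p w) -> False.
Proof.
move=> hx hy gen xw yw xx xy yy; apply: (@derived_not_line (p w)).
have st t : lie_br t w = 0 -> forall v, (exists c, p v = c *: p w) ->
    exists c, p (lie_br t v) = c *: p w.
  move=> tw v [c pv]; exists 0; rewrite scale0r.
  by rewrite (@br_lift_eq t v (c *: w)) ?linearZ // lie_brZr tw scaler0 linear0.
apply: (derived_sub_stable (W := [set v | exists c, p v = c *: p w]%classic)
  hx hy (generate_mod_center gen) nilM) => //; try exact: st.
split; first by exists 0; rewrite linear0 scale0r.
move=> c u v [c1 e1] [c2 e2]; exists (c * c1 + c2).
by rewrite linearP e1 e2 scalerDl scalerA.
Qed.

Lemma not_generated_by_first a x y (r : K) v c :
  lie_part a x -> generate_mod_derived x y ->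
  subspace_set (derived M) v -> center c -> p y = r *: p x + p v + p c -> False.
Proof.
move=> hx gen Dv Zc py; apply: (not_one_generator hx) => e.
have [l [l' [u [Du ->]]]] := gen e.
exists (l + l' * r), (l' *: v + u), (l' *: c); split.
- by have [_ DD] := lower_central_subspace M 1; apply: DD.
- exact: (subspaceZ _ (center_is_subspace M)).
- rewrite py linearP linearZ /= !scalerDr scalerDl scalerA -!addrA.
  by do 3!congr (_ + _); rewrite addrC.
Qed.

(** A nonzero coefficient of one generator in z could be inverted, expressing that generator by the
    other one, M^2 and z. *)
Lemma center_in_derived a b x y z :
  lie_part a x -> lie_part b y -> generate_mod_derived x y -> center z ->
  exists2 u, subspace_set (derived M) u & p u = p z.
Proof.
have solve a' x' y' l l' u : lie_part a' x' -> generate_mod_derived x' y' ->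
    center z -> subspace_set (derived M) u ->
    p z = l *: p x' + l' *: p y' + p u -> l' = 0.
  move=> hx gen Zz Du pz; apply: contrapT => /eqP l0.
  apply: (@not_generated_by_first a' x' y' (- (l'^-1 * l)) (- (l'^-1 *: u)) (l'^-1 *: z)) => //.
  - have DS := lower_central_subspace M 1.
    by apply: (subspaceN DS); apply: (subspaceZ _ DS).
  - exact: (subspaceZ _ (center_is_subspace M)).
  - rewrite linearN !linearZ /= pz !scalerDr scalerA [in RHS]scalerA mulVf // scale1r.
    by rewrite scaleNr scalerN -opprD [X in _ = _ + X]addrAC addKr.
move=> hx hy gen Zz; have [l [l' [u [Du pz]]]] := gen z.
have l'0 := solve _ _ _ _ _ _ hx gen Zz Du pz.
rewrite [l *: _ + _]addrC in pz.
have l0 := solve _ _ _ _ _ _ hy (generate_mod_derivedC gen) Zz Du pz.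
by exists u; rewrite // pz l0 l'0 !scale0r !add0r.
Qed.

(** If n = 1, the odd part of L is the line of [p y], so an odd x is redundant. For x even, p [x, y]
    = r p y: a nonzero r puts y in M^2 modulo the kernel, while r = 0 makes [x, y] central, so x and
    y kill [y, y] and L^2 is a line. *)
Lemma odd_dim_neq1 a x y :
  lie_part a x -> lie_part true y -> generate_mod_derived x y ->
  has_dim (@lie_part K L true) n -> n <> 1.
Proof.
move=> hx hy gen + n1; rewrite {}n1 => /has_dim_comb[o [_ _ ospan]].
have D0 : subspace_set (derived M) 0 by case: (lower_central_subspace M 1).
have Z0 : center (0 : M) by case: (center_is_subspace M).
have py0 : p y <> 0.
  move=> py0; apply: (@not_generated_by_first a x y 0 0 0) => //.
  by rewrite py0 scale0r linear0 !addr0.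
have line w : lie_part true w -> exists r, w = r *: p y.
  move=> hw; have [[c ->] [c' pyE]] := (ospan _ hw, ospan _ (p_hom.1 _ _ hy)).
  rewrite !big_ord1 in pyE *; exists (c ord0 / c' ord0).
  rewrite pyE scalerA divfK //; apply/eqP => c0.
  by apply: py0; rewrite pyE c0 scale0r.
case: a hx => hx.
  have [r pxE] := line _ (p_hom.1 _ _ hx).
  apply: (@not_generated_by_first _ y x r 0 0 hy (generate_mod_derivedC gen)) => //.
  by rewrite pxE linear0 !addr0.
have [r pv] := line _ (p_hom.1 _ _ (lie_br_part hx hy)).
have r0 : r = 0.
  apply: contrapT => /eqP r0.
  apply: (@not_generated_by_first _ x y 0 (r^-1 *: lie_br x y) 0 hx gen) => //.
    by apply: (subspaceZ _ (lower_central_subspace M 1)); apply: derived_br.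
  by rewrite scale0r linear0 addr0 add0r linearZ /= pv scalerA mulVf ?scale1r.
rewrite r0 scale0r in pv.
apply: (not_line_subalgebra (w := lie_br y y) hx hy gen).
- by rewrite (br_odd_square hx hy) (center_brr _ (kerZ pv)) scaler0.
- exact: odd_br_cube.
- by exists 0; rewrite even_br_self // linear0 scale0r.
- by exists 0; rewrite pv scale0r.
- by exists 1; rewrite scale1r.
Qed.

(** * Upper bounds on the kernel part of M^2 *)

Hypothesis (dimM : has_dim ([set u | p u = 0] `&` derived M)%classic d).

Lemma comb_nth m (s : m.-tuple M) i : (i < m)%N -> comb (fun i : 'I_m => s`_i) s`_i.
Proof.
move=> im; exists (fun j => (j == Ordinal im)%:R).
rewrite (bigD1 (Ordinal im)) //= eqxx scale1r big1 ?addr0 // => j /negPf ->.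
by rewrite scale0r.
Qed.

(** As [y, y] = 0 for y even, c = 2; three relations give d + k + 3 <= 2 + 2k. *)
Lemma derived_dim_lt3 x y z e :
  lie_part true x -> lie_part false y -> generate_mod_derived x y ->
  subspace_set (derived M) z -> center z -> p z <> 0 ->
  subspace_set (derived M) e -> (forall c, p e <> c *: p z) ->
  lie_br x e = 0 -> (d < k)%N.
Proof.
move=> hx hy gen Dz Zz z0 De ez xe.
pose g := [tuple lie_br x x; lie_br x y].
have D0 : subspace_set (derived M) 0 by case: (lower_central_subspace M 1).
suff : (d + k + 3 <= 2 + (k + k))%N by lia.
apply: (derived_relations_leq (g := fun i : 'I_2 => g`_i)
  (al := fun i : 'I_3 => [:: z; 0; e]`_i) (de := fun i : 'I_3 => [:: 0; z; 0]`_i)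
  hx hy gen nilM _ _ _ _ dimM dimL2 _ _ _ (indep_pairs3 z0 ez)).
- by case=> [[|[|//]] ?]; apply: derived_br.
- exact: (comb_nth g (i := 0)).
- exact: (comb_nth g (i := 1)).
- by rewrite even_br_self //; case: (comb_is_subspace (fun i : 'I_2 => g`_i)).
- by case=> [[|[|[|//]]] ?].
- by case=> [[|[|[|//]]] ?].
- by case=> [[|[|[|//]]] ?] /=; rewrite ?xe ?(center_brr _ Zz) ?lie_br0r addr0.
Qed.

(** Two odd generators have c = 3; four relations give d + k + 4 <= 3 + 2k. *)
Lemma derived_dim_lt4 x y z e q :
  lie_part true x -> lie_part true y -> generate_mod_derived x y ->
  subspace_set (derived M) z -> center z -> p z <> 0 ->
  subspace_set (derived M) e -> subspace_set (derived M) q ->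
  (forall c, p e <> c *: p z) ->
  lie_br x e = 0 -> lie_br x q + lie_br y e = 0 -> (d < k)%N.
Proof.
move=> hx hy gen Dz Zz z0 De Dq ez xe xqye.
pose g := [tuple lie_br x x; lie_br x y; lie_br y y].
have D0 : subspace_set (derived M) 0 by case: (lower_central_subspace M 1).
suff : (d + k + 4 <= 3 + (k + k))%N by lia.
apply: (derived_relations_leq (g := fun i : 'I_3 => g`_i)
  (al := fun i : 'I_4 => [:: z; 0; e; q]`_i)
  (de := fun i : 'I_4 => [:: 0; z; 0; e]`_i)
  hx hy gen nilM _ _ _ _ dimM dimL2 _ _ _ (indep_pairs4 z0 ez)).
- by case=> [[|[|[|//]]] ?]; apply: derived_br.
- exact: (comb_nth g (i := 0)).
- exact: (comb_nth g (i := 1)).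
- exact: (comb_nth g (i := 2)).
- by case=> [[|[|[|[|//]]]] ?].
- by case=> [[|[|[|[|//]]]] ?].
- by case=> [[|[|[|[|//]]]] ?] /=; rewrite ?xe ?xqye ?(center_brr _ Zz) ?lie_br0r ?addr0.
Qed.

(* A central element z outside ker p yields the relations [x, z] = [y, z] = 0,
   and a bracket of x, y outside the line of z modulo ker p yields two more
   ([x, e] = 0 and [x, q] + [y, e] = 0) if x and y are odd, one more otherwise. *)
Lemma center_not_ker_lt a x y z :
  lie_part a x -> lie_part true y -> generate_mod_derived x y ->
  center z -> p z <> 0 -> (d < k)%N.
Proof.
move=> hx hy gen Zz0; have [z' Dz pz] := center_in_derived hx hy gen Zz0.
have Zz : center z'.
  rewrite -[z'](subrK z); apply: (subspaceD (center_is_subspace M)) => //.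
  by apply: kerZ; rewrite linearB pz subrr.
rewrite -{}pz => {Zz0 z}; move: z' Dz Zz => z Dz Zz z0.
pose line v := exists c, p v = c *: p z.
have lineP v : ~ line v -> forall c, p v <> c *: p z.
  by move=> nl c pv; apply: nl; exists c.
have br_line t v : line v -> lie_br t v = 0.
  move=> [c pv]; rewrite (@br_lift_eq t v (c *: z)) ?linearZ //.
  by rewrite lie_brZr center_brr ?scaler0.
have nline : ~ [/\ line (lie_br x x), line (lie_br x y) & line (lie_br y y)].
  case=> lxx lxy lyy.
  by apply: (not_line_subalgebra hx hy gen _ _ lxx lxy lyy); apply: center_brr.
have DS := lower_central_subspace M 1.
have half t : 2%:R *: t = 0 -> t = 0 :> M.
  by move/eqP; rewrite scaler_eq0 (negPf two0) => /eqP.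
case: a hx => hx.
  have xyC := odd_br_comm hx hy.
  have yxx : lie_br y (lie_br x x) = - (2%:R *: lie_br x (lie_br x y)).
    by rewrite (br_odd_square hy hx) -xyC.
  have xyy := br_odd_square hx hy.
  (* Off the line, e = [x, x] and q = 2 [x, y] satisfy [x, q] + [y, e] = 0 by [yxx]. *)
  have [lxx|/lineP nxx] := pselect (line (lie_br x x)); last first.
    apply: (derived_dim_lt4 (q := 2%:R *: lie_br x y) hx hy gen Dz Zz z0 _ _ nxx).
    - exact: derived_br.
    - by apply: (subspaceZ _ DS); apply: derived_br.
    - exact: odd_br_cube.
    - by rewrite lie_brZr yxx subrr.
  have [lyy|/lineP nyy] := pselect (line (lie_br y y)); last first.
    apply: (derived_dim_lt4 (q := 2%:R *: lie_br x y) hy hx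
      (generate_mod_derivedC gen) Dz Zz z0 _ _ nyy).
    - exact: derived_br.
    - by apply: (subspaceZ _ DS); apply: derived_br.
    - exact: odd_br_cube.
    - by rewrite lie_brZr xyy subrr.
  (* Now [y, [x, x]] = [x, [y, y]] = 0, so both x and y kill e = [x, y], and q = 0 suffices. *)
  have nxy : ~ line (lie_br x y) by move=> lxy; apply: nline.
  apply: (derived_dim_lt4 (q := 0) hx hy gen Dz Zz z0 _ _ (lineP _ nxy)).
  - exact: derived_br.
  - by case: DS.
  - by apply: half; rewrite -[_ *: _]opprK -yxx br_line ?oppr0.
  - by rewrite lie_br0r add0r; apply: half; rewrite -[_ *: _]opprK -xyy br_line ?oppr0.
have lxx : line (lie_br x x) by exists 0; rewrite even_br_self // linear0 scale0r.
(* With x even, the odd y takes the first place. If [y, y] is on the line, 2 [y, [x, y]] = [x,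
   [y, y]] = 0 allows e = [x, y]; otherwise e = [y, y]. *)
have [lyy|/lineP nyy] := pselect (line (lie_br y y)).
  have nxy : ~ line (lie_br x y) by move=> lxy; apply: nline.
  apply: (derived_dim_lt3 hy hx (generate_mod_derivedC gen) Dz Zz z0 _ (lineP _ nxy)).
    exact: derived_br.
  by apply: half; rewrite -(br_odd_square hx hy) br_line.
apply: (derived_dim_lt3 hy hx (generate_mod_derivedC gen) Dz Zz z0 _ nyy).
  exact: derived_br.
exact: odd_br_cube.
Qed.

End CentralExtension.

(** * Quotients, capability and the ideal [R, F] *)

Section Quotients.
Variables (K : fieldType).
Implicit Types L M F : lieSuperalgebra K.

Lemma lie_iso_sym L M : lie_iso L M -> lie_iso M L.
Proof.
move=> [f [[fpart fbr] [g fK gK]]].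
have glin : linear g by move=> a x y; apply: (can_inj fK); rewrite linearP !gK.
pose g' : {linear M -> L} := HB.pack g (GRing.isLinear.Build K M L _ g glin).
exists g'; split; last by exists f.
split=> [b y|x y]; last by apply: (can_inj fK); rewrite fbr /= !gK.
(* The component of [g y] of the wrong parity is sent by [f] into both parts, so it vanishes. *)
rewrite -[in lie_part b y](gK y) /=; set x := g y.
have [x_ [hx ->]] := lie_part_hom_sum x; rewrite linearD => hy.
have SP c := @lie_part_subspace K M c.
case: b hy => hy.
  suff /(can_inj fK) -> : f (x_ false) = f 0 by rewrite add0r; apply: hx.
  rewrite linear0; apply: lie_part_direct; first exact: fpart.
  by rewrite -[f _](addrK (f (x_ true))); apply: subspaceB => //; apply: fpart.
suff /(can_inj fK) -> : f (x_ true) = f 0 by rewrite addr0; apply: hx.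
rewrite linear0; apply: lie_part_direct; last exact: fpart.
rewrite -[f _](addrK (f (x_ false))) [f (x_ true) + _]addrC.
by apply: subspaceB => //; apply: fpart.
Qed.

Lemma lie_quot_brE F (I : gradedIdeal F) (x y : F) :
  @lie_br K (lie_quot I) (vpi I x) (vpi I y) = vpi I (lie_br x y).
Proof. exact: lquot_brE. Qed.

Lemma lie_quot_lift F L (I : gradedIdeal F) (f : {linear F -> L}) :
  is_lie_hom f -> (forall x, subspace_set I x -> f x = 0) ->
  exists g : {linear lie_quot I -> L}, is_lie_hom g /\ forall x, g (vpi I x) = f x.
Proof.
move=> [fpart fbr] fI; pose g (u : lie_quot I) : L := f (vrepr u).
have gpi x : g (vpi I x) = f x.
  apply/eqP; rewrite -subr_eq0 -linearB; apply/eqP; apply: fI.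
  by apply/vpi_eq; rewrite vreprK.
have glin : linear g.
  by move=> a u v; rewrite -[u]vreprK -[v]vreprK -linearP !gpi linearP.
pose g' : {linear lie_quot I -> L} :=
  HB.pack g (GRing.isLinear.Build K (lie_quot I) L _ g glin).
exists g'; split=> //; split=> [b _ [x hx <-]|u v] /=.
  by rewrite gpi; apply: fpart.
by rewrite -[u]vreprK -[v]vreprK lquot_brE !gpi fbr.
Qed.

(** First isomorphism theorem for [p], the inverse coming from a chosen section. *)
Lemma capable_of_kernel_center L M (p : {linear M -> L}) :
  is_lie_hom p -> (forall y, exists x, p x = y) ->
  (forall x, p x = 0 <-> center x) -> capable L.
Proof.
move=> p_hom p_surj ker; exists M; apply: lie_iso_sym.
have [g [g_hom gE]] := lie_quot_lift (I := center_ideal M) p_hom (fun x => (ker x).2).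
exists g; split=> //; have [s sK] := choice p_surj.
exists (fun y => vpi (center_ideal M) (s y)) => [u|y]; last by rewrite gE sK.
rewrite -[u]vreprK gE; apply/vpi_eq; apply/ker.
by rewrite linearB sK subrr.
Qed.

Section KernelBracket.
Variables (F : lieSuperalgebra K) (R : gradedIdeal F).

(** Since [R, F] lies in R, bracketing it with F stays in [R, F]. Skew-symmetry on homogeneous
    components handles the other side, and brackets of homogeneous elements give the grading. *)
Lemma br_ideal_graded : is_graded_ideal (br_set R [set: F]%classic).
Proof.
set B := br_set R _; have [Rl Rr Rg] := ideal_graded R.
have BS := subspaceP B.
have Bmem r f : subspace_set R r -> subspace_set B (lie_br r f).
  by move=> Rr'; apply: sub_span; exists r => //; exists f.
have BR x : subspace_set B x -> subspace_set R x.
  by apply: span_min => [|_ [r Hr [f _ <-]]]; [apply: subspaceP|apply: Rl].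
have Bmem' r f : subspace_set R r -> subspace_set B (lie_br f r).
  move=> /Rg[r0 [r1 [[R0 h0] [R1 h1] ->]]].
  elim/homogeneous_ind: f => [f f' Bf Bf'|b f hf].
    by rewrite lie_brDl; apply: (subspaceD BS).
  rewrite lie_brDr (lie_br_skew hf h0) (lie_br_skew hf h1).
  by apply: (subspaceD BS); apply: (subspaceN BS); apply: (subspaceZ _ BS); apply: Bmem.
split=> [x y /BR|x y /BR|]; [exact: Bmem|exact: Bmem'|].
pose P x := exists x0 x1, [/\ subspace_set B x0 /\ lie_part false x0,
  subspace_set B x1 /\ lie_part true x1 & x = x0 + x1].
have SP b := @lie_part_subspace K F b.
have PS : is_subspace P.
  split.
    exists 0, 0; rewrite addr0.
    by split=> //; split; by [case: BS|case: (SP false)|case: (SP true)].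
  move=> a _ _ [x0 [x1 [[Bx0 hx0] [Bx1 hx1] ->]]] [y0 [y1 [[By0 hy0] [By1 hy1] ->]]].
  exists (a *: x0 + y0), (a *: x1 + y1); rewrite scalerDr addrACA.
  by split=> //; split; [exact: BS.2|exact: (SP false).2|exact: BS.2|exact: (SP true).2].
have PD x y : P x -> P y -> P (x + y) by apply: (subspaceD PS).
apply: span_min => // _ [r /Rg[r0 [r1 [[R0 h0] [R1 h1] ->]]] [f _ <-]].
have Phom b c s t : subspace_set R s -> lie_part b s -> lie_part c t -> P (lie_br s t).
  move=> Rs hs ht; have := lie_br_part hs ht; have B0 : subspace_set B 0 by case: BS.
  case: (b (+) c) => h; [exists 0, (lie_br s t)|exists (lie_br s t), 0];
    rewrite ?addr0 ?add0r; split=> //; split=> //; try exact: Bmem;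
    by [case: (SP false)|case: (SP true)].
elim/homogeneous_ind: f => [f f' Bf Bf'|b f hf]; first by rewrite lie_brDr; apply: PD.
by rewrite lie_brDl; apply: PD; [apply: Phom R0 h0 hf|apply: Phom R1 h1 hf].
Qed.

Definition kernel_bracket : gradedIdeal F := GradedIdeal br_ideal_graded.

Lemma derived_lie_quot (I : gradedIdeal F) :
  (derived (lie_quot I) : set (lie_quot I)) = [set vpi I x | x in derived F]%classic.
Proof.
have pi_hom : is_lie_hom (@vpi K F I : {linear F -> lie_quot I}).
  by split=> [b x hx|x y]; [exists x|rewrite lie_quot_brE].
have pi_surj u : exists x, (@vpi K F I : {linear F -> lie_quot I}) x = u.
  by exists (vrepr u); apply: vreprK.
rewrite predeqE => u; split.
  by move=> /(derived_lift pi_hom pi_surj)[x Dx <-]; exists x.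
by move=> [x /(hom_derived pi_hom) Dx <-].
Qed.

End KernelBracket.

(** * Homogeneous generators of L, and the kernel as the whole center *)

Lemma homogeneous_spanning L m n : lie_dim L m n ->
  exists e : 'I_(m + n) -> L,
    (forall i, exists b, lie_part b (e i)) /\ forall x, comb e x.
Proof.
move=> [/has_dim_comb[e0 [_ h0 s0]] /has_dim_comb[e1 [_ h1 s1]]].
exists (fun i => match split i with inl j => e0 j | inr j => e1 j end); split.
  by move=> i; case: split => j; [exists false; apply: h0|exists true; apply: h1].
move=> x; have [x0 [x1 [/s0[c0 ->] /s1[c1 ->] ->]]] := lie_part_sum x.
exists (fun i => match split i with inl j => c0 j | inr j => c1 j end).
rewrite big_split_ord /=; congr (_ + _); apply: eq_bigr => i _.
  by rewrite (unsplitK (inl i)).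
by rewrite (unsplitK (inr i)).
Qed.

(** The even part is stable under even generators, so it contains L^2 and then all of L. *)
Lemma not_even_generators L x y n :
  lie_part false x -> lie_part false y -> lie_nilpotent L ->
  (forall e, exists a b u, subspace_set (derived L) u /\ e = a *: x + b *: y + u) ->
  has_dim (@lie_part K L true) n -> n = 0%N.
Proof.
move=> hx hy nilL gen /has_dim_comb[o [oind ho _]].
have [P0 PD] := @lie_part_subspace K L false.
have even_derived : forall u, subspace_set (derived L) u -> lie_part false u.
  apply: (derived_sub_stable hx hy _ nilL (@lie_part_subspace K L false)).
  - move=> e; have [a [b [u [Du ->]]]] := gen e.
    by exists a, b, u, 0; rewrite addr0; split=> //; case: (center_is_subspace L).
  - exact: (lie_br_part hx hx).
  - exact: (lie_br_part hx hy).
  - exact: (lie_br_part hy hy).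
  - by move=> w; apply: (lie_br_part hx).
  - by move=> w; apply: (lie_br_part hy).
case: n o oind ho => // n o oind ho.
have o0 : o ord0 = 0.
  apply: lie_part_direct (ho ord0); have [a [b [u [/even_derived hu ->]]]] := gen (o ord0).
  by rewrite -addrA; apply: (PD _ _ _ hx); apply: (PD _ _ _ hy).
have o_sum : \sum_i (i == ord0)%:R *: o i = 0.
  by rewrite big1 // => i _; case: eqP => [->|_]; rewrite ?o0 ?scaler0 ?scale0r.
by have /eqP := oind (fun i => (i == ord0)%:R) o_sum ord0; rewrite eqxx oner_eq0.
Qed.

(** [d + 4 = m + 2 * n] is gamma(L) = 2 without subtraction. With k = m + n - 2, the bound d < k
    reads n < 2, and n = 1 is excluded. *)
Lemma kernel_is_center L M (p : {linear M -> L}) m n d :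
  2%:R != 0 :> K -> 3%:R != 0 :> K ->
  is_lie_hom p -> (forall y, exists x, p x = y) ->
  (forall x, p x = 0 -> center x) ->
  lie_dim L m n -> lie_nilpotent L -> (4 <= m + n)%N -> (1 <= n)%N ->
  has_dim (derived L) (m + n - 2)%N ->
  has_dim ([set u | p u = 0] `&` derived M)%classic d -> (d + 4 = m + 2 * n)%N ->
  forall z, center z -> p z = 0.
Proof.
move=> two0 three0 p_hom p_surj kerZ dimL nilL mn4 n1 dimL2 dimM dE z Zz.
apply: contrapT => pz0.
have nilM := central_extension_nilpotent p_hom kerZ nilL.
have [e [eh espan]] := homogeneous_spanning dimL.
(* The family has m + n = k + 2 vectors, the largest number that [two_generators] allows. *)
have [|i [j gen]] := two_generators dimL2 espan; first by lia.
have k1 : (1 < m + n - 2)%N by lia.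
suff [a [x [y [hx hy genM]]]] : exists a x y,
    [/\ lie_part a x, lie_part true y & generate_mod_derived p x y].
  have lt := center_not_ker_lt p_hom p_surj kerZ two0 three0 nilM dimL2 k1 dimM hx hy genM Zz pz0.
  have := odd_dim_neq1 p_hom p_surj kerZ two0 three0 nilM dimL2 k1 hx hy genM dimL.2.
  by lia.
have [a hi] := eh i; have [b hj] := eh j.
have [x hx xE] := part_lift p_hom p_surj hi.
have [y hy yE] := part_lift p_hom p_surj hj.
have genM : generate_mod_derived p x y.
  move=> u; have [r [s [v [Dv ->]]]] := gen (p u).
  have [w Dw <-] := derived_lift p_hom p_surj Dv.
  by exists r, s, w; rewrite xE yE.
(* After a swap y is odd, unless both are even, which would force n = 0. *)
case: b hy hj => [hy _|hy hj]; first by exists a, x, y.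
case: a hx hi => [hx _|hx hi].
  by exists false, y, x; split=> //; apply: generate_mod_derivedC.
suff : n = 0%N by lia.
apply: (not_even_generators hi hj nilL _ dimL.2) => u.
by have [r [s [v [Dv uE]]]] := gen u; exists r, s, v.
Qed.

End Quotients.

(** * Capability of L through the central extension F/[R, F] *)

Theorem corollary2p8 (K : fieldType) (L : lieSuperalgebra K) (m n d : nat)
    (char2 : 2%N \notin [pchar K]) (char3 : 3%N \notin [pchar K])
    (dimL : lie_dim L m n) (nilL : lie_nilpotent L)
    (mn_ge4 : (4 <= m + n)%N) (n_ge1 : (1 <= n)%N)
    (dimL2 : has_dim (derived L) (m + n - 2)%N)
    (dimML : schur_multiplier_dim L d)
    (gamma2 : m%:Z + 2 * n%:Z - 2 - d%:Z = 2) :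
  capable L.
Proof.
have two0 : 2%:R != 0 :> K by move: char2; rewrite inE.
have three0 : 3%:R != 0 :> K by move: char3; rewrite inE.
have [F [R [_ /lie_iso_sym[f [[fpart fbr] f_bij]] dimM]]] := dimML.
have f_inj := bij_inj f_bij.
(* [q] presents L as a quotient of F with kernel R. *)
pose q : {linear F -> L} := f \o (@vpi K F R : {linear F -> lie_quot R}).
have q_hom : is_lie_hom q.
  split=> [b x hx|x y] /=; first by apply: fpart; exists x.
  by rewrite -fbr lie_quot_brE.
have qker x : q x = 0 <-> subspace_set R x.
  rewrite /q /= -[X in _ = X](linear0 f); split=> [/f_inj|Rx].
    by rewrite -(linear0 (@vpi K F R)) => /vpi_eq; rewrite subr0.
  by congr (f _); rewrite -(linear0 (@vpi K F R)); apply/vpi_eq; rewrite subr0.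
pose I := kernel_bracket R.
have IR x : subspace_set I x -> subspace_set R x.
  have [Rl _ _] := ideal_graded R.
  by apply: span_min => [|_ [r Hr [y _ <-]]]; [apply: subspaceP|apply: Rl].
(* [q] factors through M = F/[R, F]; the induced [p] has kernel R/[R, F], which is central. *)
have [p [p_hom pE]] := lie_quot_lift (I := I) q_hom (fun x Ix => (qker x).2 (IR x Ix)).
have p_surj y : exists x, p x = y.
  have [g _ gK] := f_bij; exists (vpi I (vrepr (g y))).
  by rewrite pE /q /= vreprK gK.
have kerZ u : p u = 0 -> center u.
  rewrite -[u]vreprK pE => /qker Ru v; rewrite -[v]vreprK lie_quot_brE.
  rewrite -(linear0 (@vpi K F I)); apply/vpi_eq; rewrite subr0.
  by apply: sub_span; exists (vrepr u) => //; exists (vrepr v).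
apply: (capable_of_kernel_center p_hom p_surj) => u; split; first exact: kerZ.
apply: (kernel_is_center two0 three0 p_hom p_surj kerZ dimL nilL mn_ge4 n_ge1 dimL2 (d := d)).
  (* The kernel of [p] inside M^2 is exactly the Schur multiplier, so it has dimension d. *)
  suff -> : ([set u | p u = 0] `&` derived (lie_quot I))%classic = @schur_multiplier K F R by [].
  rewrite derived_lie_quot predeqE => v; split.
    by move=> [/= pv [x Dx xv]]; exists x => //; split=> //; apply/qker; rewrite -pE xv.
  by move=> [x [/qker qx Dx] <-]; split; [rewrite /= pE|exists x].
by lia.
Qed.
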